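(* Assume that the probability density function $f$ is differentiable with bounded derivative in every neighborhood of $\theta_\alpha$, and that the random variable $X$ is square integrable. Let $(a_n)_{n\ge1}$ and $(b_n)_{n\ge1}$ be two positive sequences of real numbers strictly smaller than one, decreasing towards zero, such that $$\sum_{n=1}^\infty a_n=+\infty,\quad \sum_{n=1}^\infty b_n=+\infty,\quad \sum_{n=1}^\infty a_n^2<+\infty,\quad \sum_{n=1}^\infty b_n^2<+\infty,$$ and let $(\theta_n)$, $(\widehat{\vartheta}_n)$, $(\widetilde{\vartheta}_n)$ be the associated standard and convexified algorithms. Then $$\lim_{n\to\infty}\widehat{\vartheta}_n=\vartheta_\alpha\quad\text{a.s.}\qquad\text{and}\qquad \lim_{n\to\infty}\widetilde{\vartheta}_n=\vartheta_\alpha\quad\text{a.s.}$$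
   Context: $X$ is an integrable continuous real random variable with strictly increasing cumulative distribution function $F$ and probability density function $f$. Fix $\alpha\in(0,1)$. The quantile $\theta_\alpha$ is defined by $F(\theta_\alpha)=\alpha$ and the superquantile is $\vartheta_\alpha=\mathbb{E}[X\mid X\ge\theta_\alpha]=\frac{1}{1-\alpha}\mathbb{E}[X\,\mathbf{1}_{\{X\ge\theta_\alpha\}}]$. $(X_n)$ is a sequence of independent random variables with the same distribution as $X$. Given step sequences $(a_n)$ and $(b_n)$, the algorithms are defined, for all $n\ge1$, by $$\theta_{n+1}=\theta_n-a_n\bigl(\mathbf{1}_{\{X_{n+1}\le\theta_n\}}-\alpha\bigr),$$ $$\widehat{\vartheta}_{n+1}=\widehat{\vartheta}_n+b_n\Bigl(\frac{X_{n+1}}{1-\alpha}\mathbf{1}_{\{X_{n+1}>\theta_n\}}-\widehat{\vartheta}_n\Bigr)\quad\text{(standard algorithm)},$$ $$\widetilde{\vartheta}_{n+1}=\widetilde{\vartheta}_n+b_n\Bigl(\theta_n+\frac{X_{n+1}-\theta_n}{1-\alpha}\mathbf{1}_{\{X_{n+1}>\theta_n\}}-\widetilde{\vartheta}_n\Bigr)\quad\text{(convexified algorithm)},$$ where the initial values $\theta_1,\widehat{\vartheta}_1,\widetilde{\vartheta}_1$ are arbitrary square integrable random variables such that $(\theta_1,\widehat{\vartheta}_1,\widetilde{\vartheta}_1)$ is independent of $(X_n)_{n\ge2}$. *)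

(* Defs.v *)
From HB Require Import structures.
From mathcomp Require Import all_boot all_order all_algebra.
From mathcomp Require Import all_classical all_reals all_analysis.

Set Implicit Arguments.
Unset Strict Implicit.
Unset Printing Implicit Defensive.

Import Order.TTheory GRing.Theory Num.Theory.
Import numFieldNormedType.Exports.

Local Open Scope classical_set_scope.
Local Open Scope ring_scope.

Section probability_notions.
Context {d : measure_display} {T : measurableType d} {R : realType}.
Variable P : probability T R.

Definition has_density (X : {RV P >-> R}) (f : R -> R) : Prop :=
  [/\ measurable_fun [set: R] f, (forall x, 0 <= f x) &
      forall A : set R, measurable A ->
        distribution P X A = (\int[lebesgue_measure]_(x in A) (f x)%:E)%E].

Definition identically_distributed (X Y : {RV P >-> R}) : Prop :=
  forall A : set R, measurable A -> distribution P X A = distribution P Y A.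

Definition mutually_independent (I : choiceType) (D : set I)
    (X : I -> {RV P >-> R}) : Prop :=
  forall (s : seq I) (B : I -> set R), uniq s ->
    (forall i, i \in s -> D i /\ measurable (B i)) ->
    P (\bigcap_(i in [set` s]) (X i @^-1` B i)) =
    (\prod_(i <- s) P (X i @^-1` B i))%E.

Definition independent_systems (G H : set (set T)) : Prop :=
  forall A B, G A -> H B -> P (A `&` B) = (P A * P B)%E.

Definition sigma_of_triple (U V W : {RV P >-> R}) : set (set T) :=
  preimage_set_system [set: T] (fun w => (U w, V w, W w)) measurable.

Definition sigma_of_family (I : Type) (D : set I) (X : I -> {RV P >-> R}) :
    set (set T) :=
  <<s \bigcup_(i in D) preimage_set_system [set: T] (X i) measurable >>.

(* Elementary conditional expectation E[X | A] of X given an event A. *)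
Definition expectation_given (X : T -> R) (A : set T) : R :=
  fine 'E_P[(fun w => X w * \1_A w)%R] / fine (P A).

(* q stands for the quantile of X. *)
Definition superquantile (X : {RV P >-> R}) (q : R) : R :=
  expectation_given X [set w | q <= X w].

Lemma superquantileE (X : {RV P >-> R}) (f : R -> R) (alpha q : R) :
  has_density X f -> cdf X q = alpha%:E ->
  superquantile X q =
    (1 - alpha)^-1 * fine 'E_P[(fun w => X w * \1_[set w | q <= X w] w)%R].
Proof.
move=> [mf f0 hf] Fq; rewrite /superquantile /expectation_given mulrC.
congr (_^-1 * _).
have mI (i : interval R) : measurable [set` i] by exact: measurable_itv.
have Pq : distribution P X [set q] = 0%E.
  rewrite hf// integral_set1//.
have -> : P [set w | q <= X w] = distribution P X `[q, +oo[.
  by rewrite /distribution /pushforward; congr (P _); apply/seteqP; split => w /=;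
    rewrite in_itv/= andbT.
have -> : distribution P X `[q, +oo[ = distribution P X (~` `]-oo, q]).
  rewrite -(@setU1itv _ _ _ _ false)// measureU//; last first.
    by apply/seteqP; split => // x /= [->]; rewrite in_itv/= ltxx.
  rewrite -[X in (X + _)%E]/(distribution P X [set q]) Pq add0e setCitvl.
  by [].
rewrite probability_setC// -[X in (1 - X)%E]/(cdf X q) Fq.
by rewrite -EFinB.
Qed.

End probability_notions.

Section algorithms.
Context {d : measure_display} {T : measurableType d} {R : realType}.
Variable P : probability T R.
Implicit Types (a b : nat -> R) (alpha : R).
Implicit Types X theta vartheta : nat -> {RV P >-> R}.

(* All sequences are indexed from 1; their terms of index 0 are irrelevant. *)

Definition step_sequence a : Prop :=
  [/\ forall n, (1 <= n)%N -> 0 < a n < 1,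
      forall n, (1 <= n)%N -> a n.+1 <= a n,
      a n @[n --> \oo] --> 0,
      (\sum_(1 <= n <oo) (a n)%:E)%E = +oo%E &
      (\sum_(1 <= n <oo) (a n ^+ 2)%:E < +oo)%E].

Definition quantile_algorithm alpha a X theta : Prop :=
  forall n w, (1 <= n)%N ->
    theta n.+1 w =
    theta n w - a n * ((X n.+1 w <= theta n w)%R%:R - alpha).

Definition standard_algorithm alpha b X theta vartheta : Prop :=
  forall n w, (1 <= n)%N ->
    vartheta n.+1 w =
    vartheta n w +
    b n * (X n.+1 w / (1 - alpha) * (theta n w < X n.+1 w)%R%:R
           - vartheta n w).

Definition convexified_algorithm alpha b X theta vartheta : Prop :=
  forall n w, (1 <= n)%N ->
    vartheta n.+1 w =
    vartheta n w +
    b n * (theta n w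
           + (X n.+1 w - theta n w) / (1 - alpha) * (theta n w < X n.+1 w)%R%:R
           - vartheta n w).

End algorithms.

(* Main.v *)
(** All three recursions are stochastic approximations
    [u_(n+1) = u_n + c_n (h(theta_n, X_(n+1)) - ...)] whose noise
    [c_n (h(theta_n, X_(n+1)) - m(theta_n))], with [m(t) = E[h(t, X)]], is a
    martingale difference bounded in L^2 by a constant times [c_n]. Since
    [sum c_n^2] is finite, Kolmogorov's maximal inequality makes the noise
    series converge almost surely. Subtracting the tail of that series leaves,
    along almost every trajectory, a deterministic recursion: it is driven to
    [theta_alpha] by strict monotonicity of [F] for the quantile, and it is a
    weighted average of [m(theta_n) -> m(theta_alpha)] for the two
    superquantile algorithms. The noise of the convexified algorithm grows with
    [theta_n], which is therefore truncated at each integer level; this costs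
    nothing since almost every trajectory of [theta_n] is bounded. *)

Require Import Defs.
From HB Require Import structures.
From mathcomp Require Import all_boot all_order all_algebra.
From mathcomp Require Import all_classical all_reals all_analysis.
From mathcomp Require Import measurable_realfun ring lra.

Set Implicit Arguments.
Unset Strict Implicit.
Unset Printing Implicit Defensive.

Import Order.TTheory GRing.Theory Num.Theory.
Import numFieldNormedType.Exports.
Local Open Scope classical_set_scope.
Local Open Scope ring_scope.

(** * Deterministic recursions *)

(** Above [e1] the sequence loses at least [c n * delta] per step, and these losses have an infinite
    sum, so it must come down to [e1] at some late index. From then on, a step taken from below [e1]
    lands below [e2] and a step taken from above only decreases, so the bound [e2] persists. *)
Lemma drift_eventually_le (R : realType) (z c : nat -> R) (e1 e2 delta : R) :
  0 < delta -> e1 <= e2 -> (forall n, 0 <= c n) -> series c @ \oo --> +oo ->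
  (\forall n \near \oo, (e1 < z n -> z n.+1 <= z n - c n * delta) /\
                        (z n <= e1 -> z n.+1 <= e2)) ->
  \forall n \near \oo, z n <= e2.
Proof.
move=> d0 e12 c0 coo [N _ HN].
have [m Nm zm] : exists2 m, (N <= m)%N & z m <= e1.
  apply: contrapT => H.
  have zgt m : (N <= m)%N -> e1 < z m.
    by move=> Nm; rewrite ltNge; apply/negP => zm; apply: H; exists m.
  have desc k : z (N + k)%N <= z N - (series c (N + k)%N - series c N) * delta.
    elim: k => [|k IH]; first by rewrite addn0 subrr mul0r subr0.
    have Nk : (N <= N + k)%N by exact: leq_addr.
    have [/(_ (zgt _ Nk)) h _] := HN _ Nk.
    rewrite addnS (le_trans h)// {1}/series/= big_nat_recr//=.
    by rewrite -[\sum_(0 <= k0 < N + k) _]/(series c (N + k)%N); nra.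
  (* Rank at which the accumulated drift since [N] exceeds the initial excess [z N - e1]. *)
  have /cvgryPge/(_ (series c N + (z N - e1) / delta)) [K _ HK] := coo.
  have := HK (N + K)%N (leq_addl _ _); rewrite -lerBrDl ler_pdivrMr//.
  have := desc K; have := zgt (N + K)%N (leq_addr _ _); lra.
exists m => // n /= mn.
rewrite -(subnKC mn); elim: (n - m)%N => [|k IH].
  by rewrite addn0 (le_trans zm).
have [h1 h2] := HN (m + k)%N (leq_trans Nm (leq_addr _ _)).
rewrite addnS; have [/h2//|zgt] := leP (z (m + k)%N) e1.
apply: le_trans (h1 zgt) _; have := c0 (m + k)%N; nra.
Qed.

(** The one-sided lemma is applied to [z] and to [-z] at level [e / 2]. The factor 2 leaves room for
    a step that starts inside the band and exits it. *)
Lemma drift_cvg0 (R : realType) (z c : nat -> R) :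
  (forall n, 0 <= c n) -> series c @ \oo --> +oo ->
  (forall e, 0 < e -> exists2 delta, 0 < delta &
     \forall n \near \oo, [/\ e < z n -> z n.+1 <= z n - c n * delta,
       z n < - e -> z n + c n * delta <= z n.+1,
       z n <= e -> z n.+1 <= 2 * e & - e <= z n -> - (2 * e) <= z n.+1]) ->
  z @ \oo --> 0.
Proof.
move=> c0 coo H; apply/cvgr0Pnorm_le => e e0.
have e20 : 0 < e / 2 by lra.
have [delta d0 Hd] := H _ e20.
have up : \forall n \near \oo, z n <= e.
  apply: (@drift_eventually_le _ _ c (e / 2) _ delta) => //; first lra.
  by apply: filterS Hd => n [h1 _ h3 _]; split=> // /h3; lra.
have dn : \forall n \near \oo, - z n <= e.
  apply: (@drift_eventually_le _ (-%R \o z) c (e / 2) _ delta) => //; first lra.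
  apply: filterS Hd => n [_ h1 _ h3].
  by split=> /= hz; [have := h1 ltac:(lra)|have := h3 ltac:(lra)]; lra.
near=> n; rewrite ler_norml; apply/andP; split.
  by rewrite lerNl; near: n.
by near: n.
Unshelve. all: by end_near. Qed.

(** Robbins-Monro scheme along one trajectory. Strict monotonicity of [F] keeps the drift away from
    0 as soon as [x n] is away from [q]. *)
Lemma root_finding_cvg (R : realType) (F : R -> R) (alpha q : R)
    (x c e : nat -> R) :
  {homo F : s t / s < t} -> (forall t, 0 <= F t <= 1) -> F q = alpha ->
  (forall n, 0 <= c n) -> c @ \oo --> 0 -> series c @ \oo --> +oo ->
  cvgn (series (fun n => c n * e n)) ->
  (forall n, x n.+1 = x n - c n * (F (x n) - alpha + e n)) ->
  x @ \oo --> q.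
Proof.
move=> Fincr F01 Fq c0 ccvg coo; set S := series _; set L := limn S => Scvg xE.
have SL0 : (fun n => L - S n) @ \oo --> 0.
  by rewrite -(subrr L); apply: cvgB; [exact: cvg_cst|exact: Scvg].
have SS n : S n.+1 = S n + c n * e n by rewrite /S /series/= big_nat_recr.
(* Correcting the error by the tail of the noise series removes the noise. *)
pose z n := x n - q - (L - S n).
have zE n : z n.+1 = z n - c n * (F (x n) - alpha).
  by rewrite /z xE SS; ring.
suff z0 : z @ \oo --> 0.
  have -> : x = (fun n => z n + (L - S n) + q) by apply/funext => n; rewrite /z; ring.
  by rewrite -[X in _ --> X]add0r -{1}(addr0 0); apply: cvgD;
    [exact: cvgD|exact: cvg_cst].
apply: (@drift_cvg0 _ z c) => // eps eps0.
have d1 : 0 < F (q + eps / 2) - alpha by rewrite subr_gt0 -Fq Fincr//; lra.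
have d2 : 0 < alpha - F (q - eps / 2) by rewrite subr_gt0 -Fq Fincr//; lra.
have Fle s t : s <= t -> F s <= F t.
  by rewrite le_eqVlt => /predU1P[->//|/Fincr/ltW].
(* When the noise tail is below [eps / 2], a corrected error beyond [eps] puts [x n] beyond
   [q + eps / 2] or below [q - eps / 2], where the drift is at least [delta]. A single step moves by
   at most [c n < eps], which gives the overshoot bounds. *)
set delta := Num.min (F (q + eps / 2) - alpha) (alpha - F (q - eps / 2)).
have delta1 : delta <= F (q + eps / 2) - alpha by rewrite ge_min lexx.
have delta2 : delta <= alpha - F (q - eps / 2) by rewrite ge_min lexx orbT.
exists delta; first by rewrite lt_min d1.
have al01 := F01 q; rewrite Fq in al01.
move/cvgr0Pnorm_lt : SL0 => /(_ (eps / 2) ltac:(lra)) SL0.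
move/cvgr0Pnorm_lt : ccvg => /(_ eps eps0) ccvg.
near=> n.
have : `|L - S n| < eps / 2 by near: n.
rewrite ltr_norml => /andP[l1 l2].
have cn : `|c n| < eps by near: n.
rewrite ger0_norm// in cn.
have cn0 := c0 n; have Fn := F01 (x n); have zn : z n = x n - q - (L - S n) by [].
rewrite zE; split=> h.
- have := @Fle (q + eps / 2) (x n) ltac:(lra) => h1; nra.
- have := @Fle (x n) (q - eps / 2) ltac:(lra) => h1; nra.
- nra.
- nra.
Unshelve. all: by end_near. Qed.

(** The noise is again removed by the tail of its series, with the opposite sign since it now enters
    additively. The corrected error moves a fraction [c n] of the way towards the target
    [(m n - l) + (L - S n)], which tends to 0. *)
Lemma averaging_cvg (R : realType) (l : R) (v c m e : nat -> R) :
  (forall n, 0 <= c n <= 1) -> series c @ \oo --> +oo -> m @ \oo --> l ->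
  cvgn (series (fun n => c n * e n)) ->
  (forall n, v n.+1 = v n + c n * (m n + e n - v n)) ->
  v @ \oo --> l.
Proof.
move=> c01 coo ml; set S := series _; set L := limn S => Scvg vE.
have c0 n : 0 <= c n by have /andP[] := c01 n.
have SL0 : (fun n => L - S n) @ \oo --> 0.
  by rewrite -(subrr L); apply: cvgB; [exact: cvg_cst|exact: Scvg].
have ml0 : (fun n => m n - l) @ \oo --> 0.
  by rewrite -(subrr l); apply: cvgB => //; exact: cvg_cst.
have SS n : S n.+1 = S n + c n * e n by rewrite /S /series/= big_nat_recr.
pose z n := v n - l + (L - S n).
have zE n : z n.+1 = z n + c n * ((m n - l) + (L - S n) - z n).
  by rewrite /z vE SS; ring.
suff z0 : z @ \oo --> 0.
  have -> : v = (fun n => z n - (L - S n) + l) by apply/funext => n; rewrite /z; ring.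
  by rewrite -[X in _ --> X]add0r -{1}(subr0 0); apply: cvgD;
    [exact: cvgB|exact: cvg_cst].
(* With a target within [eps / 2] of 0, an error beyond [eps] is pulled back at rate at least
   [eps / 2]. As [c n <= 1], each step is a convex combination and cannot overshoot the target. *)
apply: (@drift_cvg0 _ z c) => // eps eps0; exists (eps / 2); first lra.
move/cvgr0Pnorm_lt : SL0 => /(_ (eps / 4) ltac:(lra)) SL0.
move/cvgr0Pnorm_lt : ml0 => /(_ (eps / 4) ltac:(lra)) ml0.
near=> n.
have : `|L - S n| < eps / 4 by near: n.
rewrite ltr_norml => /andP[l1 l2].
have : `|m n - l| < eps / 4 by near: n.
rewrite ltr_norml => /andP[l3 l4].
have /andP[cn0 cn1] := c01 n.
by rewrite zE; split=> h; nra.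
Unshelve. all: by end_near. Qed.


(** * Convergence of martingale difference series *)

Lemma measurable_fun_natr_bool d (T : measurableType d) (R : realType)
    (b : T -> bool) :
  measurable_fun setT b -> measurable_fun setT (fun w => (b w)%:R : R).
Proof.
move=> mb; rewrite (_ : (fun w => _) = (fun w => if b w then 1 else 0 : R)).
  exact: measurable_fun_ifT.
by apply/funext => w; case: (b w).
Qed.

Lemma measurable_fun_g_sigma d (T : measurableType d) d' (U : measurableType d')
    (G H : set (set T)) (f : T -> U) : G `<=` <<s H >> ->
  measurable_fun setT (f : g_sigma_algebraType G -> U) ->
  measurable_fun setT (f : g_sigma_algebraType H -> U).
Proof.
move=> GH mf _ B mB; have := mf measurableT B mB.
by apply: smallest_sub => //; exact: smallest_sigma_algebra.
Qed.

Lemma measurable_fun_g_sigmaW d (T : measurableType d) d'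
    (U : measurableType d') (G : set (set T)) (f : T -> U) :
  G `<=` measurable -> measurable_fun setT (f : g_sigma_algebraType G -> U) ->
  measurable_fun setT f.
Proof.
move=> Gm mf _ B mB; have := mf measurableT B mB.
by apply: smallest_sub => //; exact: sigma_algebra_measurable.
Qed.

Section square_integrable.
Context d (T : measurableType d) (R : realType) (P : probability T R).
Implicit Types f g : T -> R.

Definition square_integrable f :=
  measurable_fun setT f /\ P.-integrable setT (EFin \o (fun w => f w ^+ 2)).

Lemma square_integrableM f g : square_integrable f -> square_integrable g ->
  P.-integrable setT (EFin \o (fun w => f w * g w)).
Proof.
move=> [mf jf] [mg jg].
apply: (@le_integrable _ _ _ P setT _ _
  (EFin \o (fun w => f w ^+ 2 + g w ^+ 2))) => //.
- by apply/measurable_EFinP; exact: measurable_funM.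
- move=> w _; rewrite /= lee_fin [leRHS]ger0_norm ?addr_ge0 ?sqr_ge0//.
  by rewrite ler_norml; apply/andP; split; nra.
- exact: (integrableD measurableT jf jg).
Qed.

Lemma square_integrableD f g : square_integrable f -> square_integrable g ->
  square_integrable (fun w => f w + g w).
Proof.
move=> [mf jf] [mg jg]; split; first exact: measurable_funD.
apply: (@le_integrable _ _ _ P setT _ _
  (EFin \o (fun w => 2 * (f w ^+ 2 + g w ^+ 2)))) => //.
- by apply/measurable_EFinP; apply: measurable_funX; exact: measurable_funD.
- move=> w _; rewrite /= lee_fin !ger0_norm ?sqr_ge0//;
    have := sqr_ge0 (f w - g w); nra.
- exact: (integrableZl measurableT 2 (integrableD measurableT jf jg)).
Qed.

Lemma square_integrable_dominated f g : measurable_fun setT f ->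
  square_integrable g -> (forall w, `|f w| <= `|g w|) -> square_integrable f.
Proof.
move=> mf [mg jg] fg; split => //.
apply: (@le_integrable _ _ _ P setT _ _ (EFin \o (fun w => g w ^+ 2))) => //.
- by apply/measurable_EFinP; exact: measurable_funX.
- by move=> w _; rewrite /= lee_fin !normrX ler_sqr ?nnegrE ?normr_ge0.
Qed.

Lemma square_integrable_cst (k : R) : square_integrable (cst k).
Proof. by split=> //; exact: (finite_measure_integrable_cst P (k ^+ 2)). Qed.

End square_integrable.

Section martingale_difference_series.
Context d (T : measurableType d) (R : realType) (P : probability T R).
Variables (G : nat -> set (set T)) (D : nat -> T -> R) (s : nat -> R).
Hypothesis Gm : forall k, G k `<=` measurable.
Hypothesis GS : forall k, G k `<=` G k.+1.
Hypothesis mD : forall k,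
  measurable_fun setT (D k : g_sigma_algebraType (G k.+1) -> R).
Hypothesis D2 : forall k, square_integrable P (D k).
Hypothesis D_le : forall k, \int[P]_w (D k w ^+ 2) <= s k.
(** The martingale difference property $E[D_k \mid \mathcal{F}_k] = 0$, expressed by testing against
    square integrable functions of the past instead of through a conditional expectation. *)
Hypothesis D_orth : forall k (U : T -> R),
  measurable_fun setT (U : g_sigma_algebraType (G k) -> R) ->
  square_integrable P U -> \int[P]_w (U w * D k w) = 0.

(* Freezing the partial sums of [D] (from rank [n] on) once they leave ]-e, e[
   turns the maximal inequality into Chebyshev's inequality at a single index,
   without any decomposition according to the first exit time. *)
Fixpoint stopped_sum (e : R) (n m : nat) (w : T) : R :=
  if m is k.+1 then
    stopped_sum e n k w + (`|stopped_sum e n k w| < e)%R%:R * D (n + k) w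
  else 0.

Let G_sub k : G k `<=` <<s G k.+1 >>.
Proof. by move=> A /GS GA; exact: sub_sigma_algebra. Qed.

Lemma measurable_stopped_sum e n m :
  measurable_fun setT (stopped_sum e n m : g_sigma_algebraType (G (n + m)) -> R).
Proof.
elim: m => [|m IH]; first exact: measurable_cst.
rewrite addnS; have mS := measurable_fun_g_sigma (@G_sub (n + m)) IH.
apply: measurable_funD => //; apply: measurable_funM; last exact: mD.
apply: measurable_fun_natr_bool; apply: measurable_fun_ltr => //.
exact: measurableT_comp.
Qed.

(** The freezing indicator depends only on the past, so each new increment is orthogonal to the
    stopped sum and second moments add up as in Pythagoras' theorem. *)
Lemma stopped_sum_square e n m : square_integrable P (stopped_sum e n m) /\
  \int[P]_w (stopped_sum e n m w ^+ 2) <= \sum_(n <= k < n + m) s k.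
Proof.
elim: m => [|m [IH1 IH2]].
  split; first exact: square_integrable_cst.
  rewrite addn0 big_geq//= /Rintegral integral0_eq// => w _.
  by rewrite expr0n.
pose I w : R := (`|stopped_sum e n m w| < e)%R%:R.
have I01 w : 0 <= I w <= 1 by rewrite /I; case: (_ < _); rewrite ?lexx ler01.
have II w : I w ^+ 2 = I w by rewrite /I; case: (_ < _); rewrite ?expr1n ?expr0n.
have mI : measurable_fun setT (I : g_sigma_algebraType (G (n + m)) -> R).
  apply: measurable_fun_natr_bool; apply: measurable_fun_ltr => //.
  by apply: measurableT_comp => //; exact: measurable_stopped_sum.
have mIT := measurable_fun_g_sigmaW (@Gm _) mI.
have ID2 : square_integrable P (fun w => I w * D (n + m) w).
  apply: (@square_integrable_dominated _ _ _ _ _ (D (n + m))) => //.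
    by apply: measurable_funM => //; exact: (D2 _).1.
  move=> w; rewrite normrM ler_piMl//; have /andP[? ?] := I01 w.
  by rewrite ger0_norm.
have IS2 : square_integrable P (fun w => I w * stopped_sum e n m w).
  apply: (@square_integrable_dominated _ _ _ _ _ (stopped_sum e n m)) => //.
    by apply: measurable_funM => //; exact: IH1.1.
  move=> w; rewrite normrM ler_piMl//; have /andP[? ?] := I01 w.
  by rewrite ger0_norm.
split; first exact: square_integrableD.
rewrite addnS big_nat_recr ?leq_addr//=.
have -> : \int[P]_w ((stopped_sum e n m w + I w * D (n + m)%N w) ^+ 2) =
   \int[P]_w (stopped_sum e n m w ^+ 2) +
   \int[P]_w ((I w * D (n + m)%N w) ^+ 2).
  (* The square is expanded; the cross term vanishes by [D_orth] with the past function
     [I * stopped_sum e n m]. *)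
  transitivity (\int[P]_w ((stopped_sum e n m w ^+ 2 +
     2 * (I w * stopped_sum e n m w * D (n + m)%N w)) +
     (I w * D (n + m)%N w) ^+ 2)).
    by apply: eq_Rintegral => w _; ring.
  have jX := square_integrableM IS2 (D2 (n + m)).
  have jX2 : P.-integrable setT (EFin \o
      (fun w => 2 * (I w * stopped_sum e n m w * D (n + m)%N w))).
    exact: (integrableZl measurableT 2 jX).
  rewrite RintegralD//; last 2 first.
  - exact: (integrableD measurableT IH1.2 jX2).
  - exact: ID2.2.
  rewrite RintegralD//; last exact: IH1.2.
  rewrite RintegralZl// (D_orth (U := fun w => I w * stopped_sum e n m w))//.
    by rewrite mulr0 addr0.
  by apply: measurable_funM => //; exact: measurable_stopped_sum.
apply: lerD => //; apply: le_trans (D_le (n + m)).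
apply: le_Rintegral => //; [exact: ID2.2|exact: (D2 _).2|].
move=> w _; rewrite exprMn II ler_piMl ?sqr_ge0//.
by have /andP[] := I01 w.
Qed.

(** Once its modulus reaches [e] the stopped sum never changes again, so a modulus below [e] means
    that no increment was suppressed. *)
Lemma stopped_sumE e n m w : `|stopped_sum e n m w| < e ->
  stopped_sum e n m w = \sum_(n <= k < n + m) D k w.
Proof.
elim: m => [|m IH]; first by rewrite addn0 big_geq.
rewrite /=; case: (ltP `|stopped_sum e n m w| e) => [lt _|ge].
  by rewrite mul1r addnS big_nat_recr ?leq_addr//= IH.
by rewrite mul0r addr0 ltNge ge.
Qed.

(** Thanks to the freezing, for [e > 0] this is the event that some partial sum from rank [n], of at
    most [m] terms, has modulus at least [e]. *)
Let A e n m := [set w | e <= `|stopped_sum e n m w|].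

Let mA e n m : measurable (A e n m).
Proof.
have := measurable_fun_g_sigmaW (@Gm _) (@measurable_stopped_sum e n m) => mS.
rewrite /A -[X in measurable X]setTI.
have := @measurable_fun_ler _ _ R setT (cst e) (fun w => `|stopped_sum e n m w|)
  (measurable_cst _) (measurableT_comp (@normr_measurable _ _) mS).
by move/(_ measurableT [set true] I).
Qed.

(** Kolmogorov's maximal inequality, obtained as Chebyshev's inequality for the stopped sum. *)
Let PA_le e n m : 0 < e -> (forall k, 0 <= s k) ->
  (P (A e n m) <= (e ^- 2 * \sum_(n <= k < n + m) s k)%:E)%E.
Proof.
move=> e0 s0; have [[mS jS] IS] := stopped_sum_square e n m.
have e20 : 0 < e ^+ 2 by rewrite exprn_gt0.
rewrite mulrC EFinM lee_pdivlMr//.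
have -> : P (A e n m) = (\int[P]_w (\1_(A e n m) w)%:E)%E.
  by rewrite integral_indic// setIT.
rewrite -(@ge0_integralZr _ _ _ _ _ measurableT)//; last 2 first.
- exact/measurable_EFinP/measurable_indic.
- by rewrite lee_fin ltW.
rewrite (@le_trans _ _ (\int[P]_w (stopped_sum e n m w ^+ 2)%:E)%E)//.
  apply: ge0_le_integral => //.
  - by move=> w _; rewrite mule_ge0 ?lee_fin// ltW.
  - by apply: emeasurable_funM => //; exact/measurable_EFinP/measurable_indic.
  - by apply/measurable_EFinP; exact: measurable_funX.
  - move=> w _; rewrite -EFinM lee_fin indicE.
    have [/set_mem Aw|_] := boolP (w \in A e n m); last by rewrite mul0r sqr_ge0.
    rewrite mul1r -(real_normK (num_real (stopped_sum e n m w))).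
    by rewrite ler_sqr ?nnegrE// ltW.
rewrite -[leLHS]fineK ?lee_fin//.
exact: (integrable_fin_num measurableT jS).
Qed.

(** The probability that a partial sum started at [n] ever reaches modulus [e] is at most [e ^- 2]
    times the tail of [series s]. Hence almost surely, for each level [e], some starting rank admits
    no such exit, which is the Cauchy criterion. *)
Lemma martingale_difference_series_cvg :
  (forall k, 0 <= s k) -> cvgn (series s) ->
  {ae P, forall w, cvgn (series (fun k => D k w))}.
Proof.
move=> s0 scvg.
pose B e n := \bigcup_m A e n m.
have mB e n : measurable (B e n) by apply: bigcupT_measurable => m; exact: mA.
have PB_le e n : 0 < e ->
    (P (B e n) <= (e ^- 2 * (limn (series s) - series s n))%:E)%E.
  move=> e0.
  (* A sum that has exited stays frozen, so the events grow with [m] and the probability of their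
     union is the limit. *)
  have AS i j : (i <= j)%N -> A e n i `<=` A e n j.
    move=> /subnK <-; elim: (j - i)%N => // k IH w /IH {IH} /=.
    rewrite /A/= => ge; rewrite (ltNge _ e) ge/= mul0r addr0//.
  have : P (A e n m) @[m --> \oo] --> P (B e n).
    apply: nondecreasing_cvg_mu.
    - by move=> m; exact: mA.
    - exact: mB.
    - by move=> i j ij; exact/subsetPset/AS.
  move=> /cvg_lim <-//; apply: lime_le.
    apply: ereal_nondecreasing_is_cvgn => i j ij.
    by apply: le_measure; rewrite ?inE//; exact: AS.
  near=> m; apply: le_trans (PA_le n m e0 s0) _.
  rewrite lee_fin ler_pM2l ?invr_gt0 ?exprn_gt0// lerBrDl.
  rewrite /series/= -big_cat_nat ?leq_addr//=.
  apply: (nondecreasing_cvgn_le _ scvg).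
  by apply/nondecreasing_series => k _ _.
have nullB e : 0 < e -> P (\bigcap_n B e n) = 0%E.
  move=> e0; apply/eqP; rewrite eq_le measure_ge0 andbT.
  have : (e ^- 2 * (limn (series s) - series s n))%:E @[n --> \oo] --> 0%E.
    apply/cvg_EFin; first by near=> n.
    rewrite -(mulr0 (e ^- 2)); apply: cvgM; first exact: cvg_cst.
    rewrite -(subrr (limn (series s))).
    by apply: cvgB; [exact: cvg_cst|exact: scvg].
  move=> /cvg_lim <-//; apply: lime_ge.
    apply/cvg_ex; eexists.
    apply/cvg_EFin; first by near=> n.
    apply: cvgM; first exact: cvg_cst.
    by apply: cvgB; [exact: cvg_cst|exact: scvg].
  near=> n; apply: le_trans (PB_le e n e0); apply: le_measure; rewrite ?inE//.
    by apply: bigcapT_measurable => k; exact: mB.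
  exact: bigcap_inf.
(* Countably many levels [1 / (j + 1)] suffice, so that the exceptional sets can be gathered into a
   single null set. *)
have : forall j, {ae P, forall w, ~ (\bigcap_n B j.+1%:R^-1 n) w}.
  move=> j; exists (\bigcap_n B j.+1%:R^-1 n); split.
  - by apply: bigcapT_measurable => k; exact: mB.
  - exact: nullB.
  - by move=> w /= /contrapT.
move/ae_foralln; apply: filterS => w Hw.
apply: cauchy_cvg; apply/cauchy_seriesP => eps eps0.
have eps20 : 0 < eps / 2 by rewrite divr_gt0.
have [j jeps] : exists j, j.+1%:R^-1 < eps / 2.
  have [j _ /(_ j (leqnn _)) ?] := near_infty_natSinv_lt (PosNum eps20).
  by exists j.
(* Otherwise, from every rank [n], the partial sums would exit at level [1 / (j + 1)], and [w] would
   lie in all the sets [B]. *)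
have [N HN] : exists N, forall m, `|\sum_(N <= k < N + m) D k w| < eps / 2.
  apply: contrapT => H; apply: (Hw j) => n _.
  apply: contrapT => H'; apply: H; exists n => m.
  have lt : `|stopped_sum j.+1%:R^-1 n m w| < j.+1%:R^-1.
    by rewrite ltNge; apply/negP => ge; apply: H'; exists m.
  by rewrite -(stopped_sumE lt) (lt_trans lt).
exists ([set n | (N <= n)%N], [set n | (N <= n)%N]) => /=.
  by split; exists N.
move=> [p q] [/= Np Nq]; have [pq|/ltnW qp] := leqP p q; last first.
  by rewrite big_geq// normr0.
(* The block from [p] to [q] is the difference of two blocks starting at [N]. *)
have := HN (p - N)%N; have := HN (q - N)%N; rewrite !subnKC//.
rewrite (big_cat_nat Np pq)/=.
rewrite !ltr_norml => /andP[? ?] /andP[? ?]; apply/andP; split; lra.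
Unshelve. all: by end_near. Qed.

End martingale_difference_series.


(** * Independence of the past *)

(** By independence the law of [(Z, Y)] is the product of the two laws, so Fubini's theorem allows
    integration in [y] first, with the value of [Z] frozen. [Z] takes values in an arbitrary
    measurable space so that it can carry the whole past. *)
Lemma independent_integral_eq0 d (T : measurableType d) (R : realType)
    (P : probability T R) d' (S : measurableType d') (Z : T -> S)
    (Y : {mfun T >-> R}) (phi : S * R -> R) :
  measurable_fun setT Z ->
  (forall A B, measurable A -> measurable B ->
     P (Z @^-1` A `&` Y @^-1` B) = (P (Z @^-1` A) * P (Y @^-1` B))%E) ->
  measurable_fun setT phi ->
  P.-integrable setT (fun w => (phi (Z w, Y w))%:E) ->
  (forall s, \int[distribution P Y]_y (phi (s, y))%:E = 0)%E ->
  (\int[P]_w (phi (Z w, Y w))%:E = 0)%E.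
Proof.
move=> mZ indep mphi jphi phi0.
have mZY : measurable_fun setT (fun w => (Z w, Y w)).
  by apply: measurable_fun_pair.
pose ZY : {mfun T >-> (S * R)%type} :=
  HB.pack (fun w => (Z w, Y w)) (isMeasurableFun.Build _ _ _ _ _ mZY).
have mE : measurable_fun setT (EFin \o phi) by exact/measurable_EFinP.
pose Z' : {mfun T >-> S} := HB.pack Z (isMeasurableFun.Build _ _ _ _ _ mZ).
pose mu := distribution P Z'; pose nu := distribution P Y.
have prodE A : measurable A -> (mu \x nu)%E A = distribution P ZY A.
  by apply: product_measure_unique => {}A B mA mB;
  exact: (indep A B mA mB).
have intE f : (\int[mu \x nu]_x f x = \int[distribution P ZY]_x f x)%E.
  by apply: eq_measure_integral => A mA _; exact: prodE.
have jD : (distribution P ZY).-integrable setT (EFin \o phi).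
  exact: (@integrable_pushforward _ _ _ _ _ ZY).
have jprod : (mu \x nu)%E.-integrable setT (EFin \o phi).
  by apply/integrableP; split => //; rewrite intE; case/integrableP : jD.
rewrite -[LHS](@integral_distribution _ _ _ _ _ P ZY (EFin \o phi))//.
rewrite -intE -integral12_prod_meas1// integral0_eq// => s _.
exact: phi0.
Qed.

Section history.
Context d (T : measurableType d) (R : realType) (P : probability T R).
Variables (E0 : set (set T)) (Y : nat -> {RV P >-> R}).
Hypothesis mE0 : E0 `<=` measurable.
Hypothesis E0I : setI_closed E0.
Hypothesis E0T : E0 setT.
Hypothesis indep : forall A0 (B : nat -> set R) k, E0 A0 ->
  (forall i, measurable (B i)) ->
  P (A0 `&` \bigcap_(i < k) Y i @^-1` B i) =
  (P A0 * \prod_(i < k) P (Y i @^-1` B i))%E.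

(* A pi-system generating the sigma-algebra of [E0] and [Y 0], ..., [Y k.-1]. *)
Definition history k : set (set T) :=
  [set C | exists2 A0, E0 A0 & exists2 B : nat -> set R,
     forall i, measurable (B i) & C = A0 `&` \bigcap_(i < k) Y i @^-1` B i].

Let mYB i B : measurable B -> measurable (Y i @^-1` B).
Proof. by move=> mB; rewrite -[X in measurable X]setTI; exact: measurable_funP. Qed.

Lemma history_measurable k : history k `<=` measurable.
Proof.
move=> _ [A0 EA0 [B mB ->]]; apply: measurableI; first exact: mE0.
by apply: bigcap_measurableType => i _; exact: mYB.
Qed.

Lemma history_setI k : setI_closed (history k).
Proof.
move=> _ _ [A1 E1 [B1 mB1 ->]] [A2 E2 [B2 mB2 ->]].
exists (A1 `&` A2); first exact: E0I.
exists (fun i => B1 i `&` B2 i); first by move=> i; exact: measurableI.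
by rewrite setIACA -bigcapI.
Qed.

Lemma history_setT k : history k setT.
Proof.
exists setT => //; exists (fun=> setT) => //.
by rewrite setTI; apply/seteqP; split => // w _ i _.
Qed.

Lemma sub_history k : history k `<=` history k.+1.
Proof.
move=> _ [A0 EA0 [B mB ->]]; exists A0 => //.
exists (fun i => if (i < k)%N then B i else setT) => [i|]; first by case: ifP.
congr (_ `&` _); apply/seteqP; split => w H i /= ik.
  by case: ifPn => // ik'; exact: H.
by have := H i (ltnW ik); rewrite /= ik.
Qed.

Lemma history_ini A0 k : E0 A0 -> history k A0.
Proof.
move=> EA0; exists A0 => //; exists (fun=> setT) => //.
by rewrite (_ : \bigcap_(i < k) _ = setT) ?setIT//; apply/seteqP; split.
Qed.

Lemma measurable_fun_history k :
  measurable_fun setT (Y k : g_sigma_algebraType (history k.+1) -> R).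
Proof.
move=> _ B mB; rewrite setTI; apply: sub_sigma_algebra.
exists setT => //; exists (fun i => if i == k then B else setT) => [i|].
  by case: ifP.
rewrite setTI; apply/seteqP; split => w.
  by move=> H i /= _; case: eqP => // ->.
by move=> /(_ k (ltnSn k)) /=; rewrite eqxx.
Qed.

(** As functions of [A], both sides are finite measures: [P] restricted to the event on [Y k], and
    [P] scaled by the probability of that event. They agree on the generating pi-system, hence on
    the sigma-algebra. *)
Lemma history_independent k (A : set T) (B : set R) : <<s history k >> A ->
  measurable B -> P (A `&` Y k @^-1` B) = (P A * P (Y k @^-1` B))%E.
Proof.
move=> hA mB; have mYkB := mYB k mB.
have PYfin : P (Y k @^-1` B) \is a fin_num by exact: fin_num_measure.
have r0 : 0 <= fine (P (Y k @^-1` B)) by rewrite fine_ge0.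
pose m2 : {measure set T -> \bar R} := mscale (NngNum r0) P.
pose m1 : {measure set T -> \bar R} := mrestr P mYkB.
suff : m1 A = m2 A.
  by rewrite /m1 /m2 /= /mrestr /mscale/= fineK// muleC.
apply: (g_sigma_algebra_measure_unique (history k) _ (fun=> setT)) hA.
- exact: history_measurable.
- by move=> _; exact: history_setT.
- by apply/seteqP; split => // w _; exists 0%N.
- exact: history_setI.
- move=> _ [A0 EA0 [C mC ->]].
  rewrite /m1 /m2 /= /mrestr /mscale/= fineK//.
  rewrite indep// muleC -muleA.
  (* Adding [B] as a constraint of index [k] turns the event into one of [history k.+1], to which
     [indep] applies. *)
  pose C' i := if i == k then B else C i.
  have -> : A0 `&` \bigcap_(i < k) Y i @^-1` C i `&` Y k @^-1` B =
      A0 `&` \bigcap_(i < k.+1) Y i @^-1` C' i.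
    rewrite -setIA; congr (_ `&` _); apply/seteqP; split => w.
      move=> [H1 H2] i /=; rewrite /C' ltnS leq_eqVlt.
      by case: eqP => [->//|_ /= ik]; exact: H1.
    move=> H; split.
      move=> i /= ik; have := H i (ltnW ik); rewrite /C'/=.
      by rewrite (ltn_eqF ik).
    by have := H k (ltnSn k); rewrite /C'/= eqxx.
  rewrite indep//; last by move=> i; rewrite /C'; case: ifP.
  rewrite big_ord_recr/= {2}/C' eqxx; congr (_ * (_ * _))%E.
  by apply: eq_bigr => i _; rewrite /C' (ltn_eqF (ltn_ord i)).
- move=> _; rewrite /m1 /= /mrestr setTI (le_lt_trans (probability_le1 _ _))//.
  by rewrite ltry.
Qed.

End history.


(** * Convergence of the noise *)

Lemma square_integrableZ d (T : measurableType d) (R : realType)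
    (P : probability T R) (k : R) (f : T -> R) :
  square_integrable P f -> square_integrable P (fun w => k * f w).
Proof.
move=> [mf jf]; split; first exact: measurable_funM.
rewrite (_ : EFin \o _ =
    (fun w => (k ^+ 2)%:E * (f w ^+ 2)%:E)%E).
  exact: (integrableZl measurableT _ jf).
by apply/funext => w /=; rewrite exprMn EFinM.
Qed.

Lemma square_integrable_norm d (T : measurableType d) (R : realType)
    (P : probability T R) (f : T -> R) :
  square_integrable P f -> square_integrable P (fun w => `|f w|).
Proof.
move=> sf; apply: (square_integrable_dominated _ sf) => [|w].
  by apply: measurableT_comp => //; exact: sf.1.
by rewrite normr_id.
Qed.

Lemma square_integrableW d (T : measurableType d) (R : realType)
    (P : probability T R) (f : T -> R) :
  square_integrable P f -> P.-integrable setT (EFin \o f).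
Proof.
move=> sf; have := square_integrableM sf (square_integrable_cst P 1).
by under eq_fun do rewrite mulr1.
Qed.

Lemma measurable_fun_comp2 d (T : measurableType d) (R : realType)
    (h : R -> R -> R) (u v : T -> R) :
  measurable_fun setT (fun z : R * R => h z.1 z.2) ->
  measurable_fun setT u -> measurable_fun setT v ->
  measurable_fun setT (fun w => h (u w) (v w)).
Proof.
move=> mh mu mv.
apply: (@measurableT_comp _ _ _ _ _ _ (fun z : R * R => h z.1 z.2) _
  (fun w => (u w, v w))) => //.
exact: measurable_fun_pair.
Qed.

Section sublinear.
Context d (T : measurableType d) (R : realType) (P : probability T R).
Variables (X : {RV P >-> R}) (h : R -> R -> R) (C : R).
Hypothesis X2 : square_integrable P X.
Hypothesis mh : measurable_fun setT (fun z : R * R => h z.1 z.2).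
Hypothesis hC : forall t y, `|h t y| <= C * (1 + `|y|).

Definition mean t := \int[P]_w h t (X w).

Let C0 : 0 <= C.
Proof. by have := le_trans (normr_ge0 _) (hC 0 0); rewrite normr0 addr0 mulr1. Qed.

Lemma measurable_sublinear t : measurable_fun setT (h t).
Proof. exact: measurable_fun_comp2. Qed.

Let jC : P.-integrable setT (EFin \o (fun w => C * (1 + `|X w|))).
Proof.
apply: square_integrableW; apply: square_integrableZ.
apply: square_integrableD; first exact: square_integrable_cst.
exact: square_integrable_norm.
Qed.

Lemma integrable_sublinear t : P.-integrable setT (EFin \o (fun w => h t (X w))).
Proof.
apply: (le_integrable measurableT _ _ jC) => [|w _].
  apply/measurable_EFinP; apply: measurableT_comp => //.
  exact: measurable_sublinear.
rewrite /= lee_fin [leRHS]ger0_norm; first exact: hC.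
by rewrite mulr_ge0// addr_ge0.
Qed.

Let M := \int[P]_w (C * (1 + `|X w|)).

Lemma mean_le t : `|mean t| <= M.
Proof.
apply: le_trans (le_normr_Rintegral _ (integrable_sublinear t)) _ => //.
apply: le_Rintegral => //.
exact: integrable_norm (integrable_sublinear t).
Qed.

Lemma measurable_mean : measurable_fun setT mean.
Proof.
(* The added term makes the integrand nonnegative, so that Tonelli applies. *)
pose f (z : R * R) := (h z.1 z.2 + C * (1 + `|z.2|))%:E.
have f0 z : (0 <= f z)%E.
  rewrite lee_fin; have := hC z.1 z.2; rewrite ler_norml => /andP[+ _]; lra.
have mf : measurable_fun setT f.
  apply/measurable_EFinP; apply: measurable_funD => //.
  apply: measurable_funM => //; apply: measurable_funD => //.
  apply: measurableT_comp => //; exact: measurable_snd.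
have := @measurable_fun_fubini_tonelli_F _ _ _ _ _ (distribution P X) f mf f0.
have -> : fubini_F (distribution P X) f = (fun t => (mean t + M)%:E).
  apply/funext => t; rewrite /fubini_F.
  have mft : measurable_fun setT (fun y => f (t, y)).
    by apply: (measurableT_comp mf); exact: measurable_fun_pair.
  rewrite ge0_integral_distribution//.
  rewrite /mean /M -RintegralD//; last exact: integrable_sublinear.
  rewrite /Rintegral fineK//; apply: integrable_fin_num => //.
  exact: (integrableD measurableT (integrable_sublinear t) jC).
move/measurable_EFinP => mm.
rewrite (_ : mean = (fun t => (mean t + M) - M)); last first.
  by apply/funext => t; rewrite addrK.
exact: measurable_funB.
Qed.

End sublinear.

Section noise.
Context d (T : measurableType d) (R : realType) (P : probability T R).
Variables (E0 : set (set T)) (Y : nat -> {RV P >-> R}).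
Hypothesis mE0 : E0 `<=` measurable.
Hypothesis E0I : setI_closed E0.
Hypothesis E0T : E0 setT.
Hypothesis indep : forall A0 (B : nat -> set R) k, E0 A0 ->
  (forall i, measurable (B i)) ->
  P (A0 `&` \bigcap_(i < k) Y i @^-1` B i) =
  (P A0 * \prod_(i < k) P (Y i @^-1` B i))%E.
Variables (X : {RV P >-> R}) (h : R -> R -> R) (C : R).
Hypothesis X2 : square_integrable P X.
Hypothesis YX : forall k, identically_distributed (Y k) X.
Hypothesis mh : measurable_fun setT (fun z : R * R => h z.1 z.2).
Hypothesis hC : forall t y, `|h t y| <= C * (1 + `|y|).
Variables (x : nat -> T -> R) (c : nat -> R).
Hypothesis mx : forall k,
  measurable_fun setT (x k : g_sigma_algebraType (history E0 Y k) -> R).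
Hypothesis c2 : cvgn (series (fun k => c k ^+ 2)).

Let ge0_integralYX k (f : R -> \bar R) : measurable_fun setT f ->
  (forall y, 0 <= f y)%E -> (\int[P]_w f (Y k w) = \int[P]_w f (X w))%E.
Proof.
move=> mf f0.
transitivity (\int[distribution P (Y k)]_y f y)%E.
  by rewrite ge0_integral_distribution.
transitivity (\int[distribution P X]_y f y)%E.
  by apply: eq_measure_integral => A mA _; exact: YX.
by rewrite ge0_integral_distribution.
Qed.

Let D k w := c k * (h (x k w) (Y k w) - mean X h (x k w)).
Let M := \int[P]_w (C * (1 + `|X w|)).
(** Dominates the centred function [h t y - mean X h t] uniformly in [t], so the second moment of
    [D k] is at most a constant times [c k ^+ 2], wherever [x k] may be. *)
Let q (y : R) := C * (1 + `|y|) + M.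

Let mq : measurable_fun setT q.
Proof.
apply: measurable_funD => //; apply: measurable_funM => //.
by apply: measurable_funD => //; exact: measurableT_comp.
Qed.

Let D_bound t y : `|h t y - mean X h t| <= q y.
Proof.
by apply: le_trans (ler_normB _ _) _; apply: lerD => //; exact: mean_le.
Qed.

Let qX2 : square_integrable P (fun w => q (X w)).
Proof.
apply: square_integrableD; last exact: square_integrable_cst.
apply: square_integrableZ.
apply: square_integrableD; first exact: square_integrable_cst.
exact: square_integrable_norm.
Qed.

Let qY2 k : square_integrable P (fun w => q (Y k w)) /\
  \int[P]_w (q (Y k w) ^+ 2) = \int[P]_w (q (X w) ^+ 2).
Proof.
have mq2 : measurable_fun setT (fun y => (q y ^+ 2)%:E).
  by apply/measurable_EFinP; exact: measurable_funX.
have E := ge0_integralYX k mq2 (fun y => sqr_ge0 (q y)).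
split; last by rewrite /Rintegral E.
split; first exact: measurableT_comp.
apply/integrableP; split; first by apply: (measurableT_comp mq2).
under eq_integral do rewrite /= ger0_norm ?sqr_ge0//.
rewrite E; case: qX2 => _ /integrableP[_].
by under eq_integral do rewrite /= ger0_norm ?sqr_ge0//.
Qed.

Let mmean := measurable_mean X2 mh hC.

Let mD k : measurable_fun setT
  (D k : g_sigma_algebraType (history E0 Y k.+1) -> R).
Proof.
have mxS : measurable_fun setT
    (x k : g_sigma_algebraType (history E0 Y k.+1) -> R).
  have sub : history E0 Y k `<=` <<s history E0 Y k.+1 >>.
    by move=> A hA; apply: sub_sigma_algebra; exact: sub_history.
  exact: (measurable_fun_g_sigma sub (@mx k)).
have mYS := measurable_fun_history E0T (k := k).
apply: measurable_funM => //; apply: measurable_funB.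
  exact: measurable_fun_comp2.
exact: (measurableT_comp mmean).
Qed.

Let hm := history_measurable mE0 (Y := Y).

Let D2 k : square_integrable P (D k).
Proof.
apply: (@square_integrable_dominated _ _ _ _ _ (fun w => c k * q (Y k w))).
- exact: measurable_fun_g_sigmaW (@hm k.+1) (@mD k).
- by apply: square_integrableZ; exact: (qY2 k).1.
- move=> w; rewrite !normrM ler_wpM2l//.
  exact: le_trans (D_bound _ _) (ler_norm _).
Qed.

Let D_orth k (U : T -> R) :
  measurable_fun setT (U : g_sigma_algebraType (history E0 Y k) -> R) ->
  square_integrable P U -> \int[P]_w (U w * D k w) = 0.
Proof.
move=> mU U2.
(* Fubini applies to the identity of T, valued in T with the sigma-algebra of
   the past, and the independent variable [Y k]. *)
have mid : measurable_fun setT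
    (idfun : T -> g_sigma_algebraType (history E0 Y k)).
  by apply: measurable_fun_g_sigmaW (@hm k) _; exact: measurable_id.
pose phi (z : g_sigma_algebraType (history E0 Y k) * R) :=
  U z.1 * (c k * (h (x k z.1) z.2 - mean X h (x k z.1))).
have mx1 : measurable_fun setT
    (fun z : g_sigma_algebraType (history E0 Y k) * R => x k z.1).
  by apply: (measurableT_comp (@mx k)); exact: measurable_fst.
have mphi : measurable_fun setT phi.
  apply: measurable_funM.
    by apply: (measurableT_comp mU); exact: measurable_fst.
  apply: measurable_funM => //; apply: measurable_funB.
    exact: measurable_fun_comp2.
  exact: (measurableT_comp mmean).
suff : (\int[P]_w (phi (w, Y k w))%:E = 0)%E by rewrite /Rintegral => ->.
apply: (independent_integral_eq0 mid) => //.
- by move=> A B mA mB; exact: (history_independent mE0 E0I E0T indep).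
- exact: square_integrableM U2 (D2 k).
move=> s.
have ms : measurable_fun setT (fun y => (phi (s, y))%:E).
  by apply/measurable_EFinP; apply: (measurableT_comp mphi); exact: measurable_fun_pair.
transitivity (\int[distribution P X]_y (phi (s, y))%:E)%E.
  by apply: eq_measure_integral => A mA _; exact: YX.
have jh := integrable_sublinear X2 mh hC (x k s).
have jcst : P.-integrable setT (EFin \o cst (mean X h (x k s))).
  exact: finite_measure_integrable_cst.
have jB : P.-integrable setT
    (EFin \o (fun w => h (x k s) (X w) - mean X h (x k s))).
  exact: (integrableB measurableT jh jcst).
have jcB : P.-integrable setT
    (EFin \o (fun w => c k * (h (x k s) (X w) - mean X h (x k s)))).
  exact: (integrableZl measurableT (c k) jB).
rewrite integral_distribution//; last exact: (integrableZl measurableT (U s) jcB).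
rewrite -[LHS]fineK; last first.
  by apply: integrable_fin_num => //; exact: (integrableZl measurableT (U s) jcB).
rewrite -[fine _]/(\int[P]_w (U s * (c k * (h (x k s) (X w) - mean X h (x k s))))).
(* With the past frozen at [s], the factors [U s] and [c k] come out, and what remains is the
   integral of [h (x k s) (X w)] minus its own mean. *)
rewrite !RintegralZl// RintegralB// Rintegral_cst//.
rewrite [X in fine X](probability_setT P) mulr1.
by rewrite subrr !mulr0.
Qed.

Lemma noise_series_cvg :
  {ae P, forall w, cvgn (series (fun k =>
     c k * (h (x k w) (Y k w) - mean X h (x k w))))}.
Proof.
pose K := \int[P]_w (q (X w) ^+ 2).
apply: (@martingale_difference_series_cvg _ _ _ P (history E0 Y) D
  (fun k => K * c k ^+ 2)) => //.
- by move=> k; exact: sub_history.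
- move=> k; rewrite /K -(qY2 k).2 mulrC -RintegralZl//; last exact: (qY2 k).1.2.
  apply: le_Rintegral => //.
  + exact: (D2 k).2.
  + exact: (integrableZl measurableT _ (qY2 k).1.2).
  + move=> w _; rewrite -exprMn -[leLHS]real_normK ?num_real//.
    rewrite -[leRHS]real_normK ?num_real// ler_sqr ?nnegrE//.
    by rewrite !normrM ler_wpM2l// (le_trans (D_bound _ _))// ler_norm.
- by move=> k; rewrite mulr_ge0 ?sqr_ge0// Rintegral_ge0// => w _; exact: sqr_ge0.
- rewrite (_ : (fun k => _) = K *: (fun k => c k ^+ 2)); last first.
    by apply/funext => k; rewrite fctE.
  exact: is_cvg_seriesZ.
Qed.

End noise.


(** * Averaging along the quantile algorithm *)

Lemma cvg_seq_normr_le (R : realType) (t : nat -> R) : cvgn t ->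
  exists2 M, 0 < M & forall n, `|t n| <= M.
Proof.
move=> /cvg_seq_bounded/pinfty_ex_gt0[M M0 tM].
by exists M => // n; exact: tM.
Qed.

Section step_sequences.
Context (R : realType) (a : nat -> R).
Hypothesis ha : step_sequence a.
(** The shift turns indexing from 1 into the indexing from 0 used by the deterministic
    recursions. *)
Let c n := a n.+1.

Lemma step_sequence_bounds n : 0 < c n < 1.
Proof. by have [a01 _ _ _ _] := ha; exact: a01. Qed.

Lemma step_sequence_cvg0 : c @ \oo --> 0.
Proof. by have [_ _ a0 _ _] := ha; rewrite (cvg_shiftS a). Qed.

Lemma step_sequence_series : series c @ \oo --> +oo.
Proof.
have [_ _ _ aoo _] := ha; apply/cvgryPge => A.
have cS m n : (m <= n)%N -> series c m <= series c n.
  apply: (nondecreasing_series (P := xpredT)) => k _ _.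
  by have /andP[/ltW] := step_sequence_bounds k.
have [N AN] : exists N, A <= series c N.
  apply: contrapT => H.
  suff : (+oo <= A%:E)%E by rewrite leye_eq.
  rewrite -aoo; apply: lime_le.
    apply: is_cvg_nneseries => n n1 _.
    by case: n n1 => // n _; rewrite lee_fin; have /andP[/ltW] := step_sequence_bounds n.
  near=> n; rewrite sumEFin lee_fin; apply/ltW; rewrite ltNge; apply/negP => h.
  (* The sum over [1 <= i < n] has [n.-1] terms, hence equals [series c n.-1]. *)
  apply: H; exists n.-1; apply: le_trans h _.
  rewrite /series/= -(big_add1 _ _ 0%N n xpredT a).
  by rewrite big_add1.
near=> n; apply: le_trans AN _; apply: cS; near: n; exact: nbhs_infty_ge.
Unshelve. all: by end_near. Qed.

Lemma step_sequence_sqr : cvgn (series (fun n => c n ^+ 2)).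
Proof.
have [_ _ _ _ a2] := ha; apply: nondecreasing_is_cvgn.
  by apply: nondecreasing_series => k _ _; exact: sqr_ge0.
set S := (\sum_(1 <= n <oo) (a n ^+ 2)%:E)%E in a2.
exists (fine S) => _ [n _ <-].
have Sge k : (\sum_(1 <= i < k) (a i ^+ 2)%:E <= S)%E.
  by apply: nneseries_lim_ge => i _ _; rewrite lee_fin sqr_ge0.
rewrite -lee_fin fineK; last first.
  by rewrite ge0_fin_numE//; apply: le_trans (Sge 0%N); rewrite big_geq.
apply: le_trans (Sge n.+1); rewrite sumEFin lee_fin big_add1//.
Qed.

End step_sequences.

Section mean_convergence.
Context d (T : measurableType d) (R : realType) (P : probability T R).
Variables (X : {RV P >-> R}) (h : R -> R -> R) (q : R).
Hypothesis X2 : square_integrable P X.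
Hypothesis Xq : P (X @^-1` [set q]) = 0.
Hypothesis mh : measurable_fun setT (fun z : R * R => h z.1 z.2).
Hypothesis h_bound : forall K, exists C, forall t y, `|t| <= K ->
  `|h t y| <= C * (1 + `|y|).
Hypothesis h_cvg : forall (t : nat -> R) y, y != q -> t @ \oo --> q ->
  h (t n) y @[n --> \oo] --> h q y.

(** Dominated convergence: a convergent [t] is bounded, so one constant [C] serves all indices, and
    pointwise convergence can fail only on the null event where [X] equals [q]. *)
Lemma mean_cvg (t : nat -> R) : t @ \oo --> q ->
  mean X h (t n) @[n --> \oo] --> mean X h q.
Proof.
move=> tq.
have [M M0 tM] : exists2 M, 0 < M & forall n, `|t n| <= M.
  by apply: cvg_seq_normr_le; apply/cvg_ex; exists q.
have [C hC] := h_bound M.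
have mht s : measurable_fun setT (fun w => h s (X w)).
  by apply: measurable_fun_comp2.
have jC : P.-integrable setT (EFin \o (fun w => C * (1 + `|X w|))).
  apply: square_integrableW; apply: square_integrableZ.
  apply: square_integrableD; first exact: square_integrable_cst.
  exact: square_integrable_norm.
have [|||//||jq _ cv] := @dominated_convergence _ _ _ P setT measurableT
  (fun n w => (h (t n) (X w))%:E) (fun w => (h q (X w))%:E)
  (EFin \o (fun w => C * (1 + `|X w|))).
- by move=> n; exact/measurable_EFinP.
- exact/measurable_EFinP.
- exists (X @^-1` [set q]); split => //.
  move=> w /=; apply: contra_notP => Xw _.
  by apply: cvg_EFin; [exact: nearW|apply: h_cvg => //; exact/eqP].
- by apply: aeW => w n _; rewrite lee_fin; exact: hC.
have fin := integrable_fin_num measurableT jq.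
by apply: fine_cvg; rewrite fineK.
Qed.

End mean_convergence.

Section averaging_algorithm.
Context d (T : measurableType d) (R : realType) (P : probability T R).
Variables (E0 : set (set T)) (Y : nat -> {RV P >-> R}).
Hypothesis mE0 : E0 `<=` measurable.
Hypothesis E0I : setI_closed E0.
Hypothesis E0T : E0 setT.
Hypothesis indep : forall A0 (B : nat -> set R) k, E0 A0 ->
  (forall i, measurable (B i)) ->
  P (A0 `&` \bigcap_(i < k) Y i @^-1` B i) =
  (P A0 * \prod_(i < k) P (Y i @^-1` B i))%E.
Variables (X : {RV P >-> R}) (h : R -> R -> R) (q : R).
Hypothesis X2 : square_integrable P X.
Hypothesis YX : forall k, identically_distributed (Y k) X.
Hypothesis Xq : P (X @^-1` [set q]) = 0.
Hypothesis mh : measurable_fun setT (fun z : R * R => h z.1 z.2).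
Hypothesis h_bound : forall K, exists C, forall t y, `|t| <= K ->
  `|h t y| <= C * (1 + `|y|).
Hypothesis h_cvg : forall (t : nat -> R) y, y != q -> t @ \oo --> q ->
  h (t n) y @[n --> \oo] --> h q y.
Variables (x v : nat -> T -> R) (c : nat -> R).
Hypothesis mx : forall k,
  measurable_fun setT (x k : g_sigma_algebraType (history E0 Y k) -> R).
Hypothesis c01 : forall n, 0 <= c n <= 1.
Hypothesis coo : series c @ \oo --> +oo.
Hypothesis c2 : cvgn (series (fun k => c k ^+ 2)).
Hypothesis vE : forall n w,
  v n.+1 w = v n w + c n * (h (x n w) (Y n w) - v n w).
Hypothesis xq : {ae P, forall w, x n w @[n --> \oo] --> q}.

Let clip (K t : R) := Num.max (- K) (Num.min K t).

Let clip_le K t : 0 <= K -> `|clip K t| <= K.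
Proof.
move=> K0; rewrite ler_norml /clip le_max lexx/= ge_max; apply/andP; split.
  lra.
by rewrite ge_min lexx.
Qed.

Let clip_id K t : `|t| <= K -> clip K t = t.
Proof.
rewrite ler_norml => /andP[t1 t2].
by rewrite /clip (min_idPr t2) (max_idPr t1).
Qed.

Let mclip K : measurable_fun setT (clip K).
Proof. by apply: measurable_maxr => //; exact: measurable_minr. Qed.

(** The function [h] grows linearly in [y] only for bounded [t], so the noise is treated with
    [h (clip K t)] for every integer [K], off a common null set. A convergent trajectory is bounded,
    and clipping at an integer above its bound leaves it unchanged. *)
Lemma averaging_algorithm_cvg :
  {ae P, forall w, v n w @[n --> \oo] --> mean X h q}.
Proof.
have noise (K : nat) : {ae P, forall w, cvgn (series (fun k =>
    c k * (h (clip K%:R (x k w)) (Y k w) -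
           mean X (fun t => h (clip K%:R t)) (x k w))))}.
  have [C hC] := h_bound K%:R.
  apply: (noise_series_cvg mE0 E0I E0T indep X2 YX (C := C)
    (h := fun t => h (clip K%:R t))) => //.
    apply: (measurable_fun_comp2 mh) => //=.
    by apply: measurableT_comp => //; exact: measurable_fst.
  by move=> t y; apply: hC; exact: clip_le.
have {}noise := ae_foralln noise.
apply: filterS2 noise xq => w noise xqw.
have [M M0 xM] : exists2 M, 0 < M & forall n, `|x n w| <= M.
  by apply: cvg_seq_normr_le; apply/cvg_ex; exists q.
have {}xM n : `|x n w| <= (Num.truncn M).+1%:R.
  apply: le_trans (xM n) _; apply/ltW.
  by have /andP[] := truncn_itv (ltW M0).
apply: (@averaging_cvg _ _ _ c (fun n => mean X h (x n w))
  (fun n => h (x n w) (Y n w) - mean X h (x n w))) => //.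
- exact: (mean_cvg X2 Xq mh).
- have := noise (Num.truncn M).+1.
  by under eq_fun do rewrite /mean !clip_id//.
- by move=> n; rewrite vE; congr (_ + _ * (_ - _)); rewrite addrC subrK.
Qed.

End averaging_algorithm.


(** * The three algorithms *)

(** Away from the jump at [y = q], the indicator is eventually constant along [t]. *)
Lemma cvg_natr_lt (R : realType) (t : nat -> R) (q y : R) : y != q ->
  t @ \oo --> q -> (t n < y)%R%:R @[n --> \oo] --> ((q < y)%R%:R : R).
Proof.
move=> yq tq; apply: cvg_near_cst.
have [qy|yltq|yE] := ltgtP q y; last by rewrite yE eqxx in yq.
- near=> n; have -> // : t n < y.
  by near: n; exact: cvgr_lt tq _ qy.
- near=> n; suff : y < t n by move=> /ltW; rewrite leNgt => /negbTE ->.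
  by near: n; exact: cvgr_gt tq _ yltq.
Unshelve. all: by end_near. Qed.

Lemma distribution_set1 d (T : measurableType d) (R : realType)
    (P : probability T R) (X : {RV P >-> R}) (f : R -> R) (q : R) :
  has_density X f -> P (X @^-1` [set q]) = 0.
Proof.
by move=> [mf f0 hf]; rewrite -[LHS]/(distribution P X [set q]) hf// integral_set1.
Qed.

Section algorithm_functions.
Context (R : realType) (alpha : R).

Definition quantile_fun (t y : R) : R := (y <= t)%R%:R.

Definition standard_fun (t y : R) : R := y / (1 - alpha) * (t < y)%R%:R.

Definition convexified_fun (t y : R) : R :=
  t + (y - t) / (1 - alpha) * (t < y)%R%:R.

Let mfst : measurable_fun setT (fst : R * R -> R).
Proof. exact: measurable_fst. Qed.

Let msnd : measurable_fun setT (snd : R * R -> R).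
Proof. exact: measurable_snd. Qed.

Lemma measurable_quantile_fun :
  measurable_fun setT (fun z : R * R => quantile_fun z.1 z.2).
Proof. by apply: measurable_fun_natr_bool; exact: measurable_fun_ler. Qed.

Let mlt : measurable_fun setT (fun z : R * R => (z.1 < z.2)%R%:R : R).
Proof. by apply: measurable_fun_natr_bool; exact: measurable_fun_ltr. Qed.

Lemma measurable_standard_fun :
  measurable_fun setT (fun z : R * R => standard_fun z.1 z.2).
Proof. by apply: measurable_funM => //; exact: measurable_funM. Qed.

Lemma measurable_convexified_fun :
  measurable_fun setT (fun z : R * R => convexified_fun z.1 z.2).
Proof.
apply: measurable_funD => //; apply: measurable_funM => //.
by apply: measurable_funM => //; exact: measurable_funB.
Qed.

Lemma quantile_fun_bound t y : `|quantile_fun t y| <= 1 * (1 + `|y|).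
Proof.
rewrite /quantile_fun mul1r ger0_norm// (@le_trans _ _ 1)//.
  by case: (y <= t).
by rewrite lerDl.
Qed.

Hypothesis alpha1 : alpha < 1.

Let i0 : 0 <= (1 - alpha)^-1.
Proof. by rewrite invr_ge0 subr_ge0 ltW. Qed.

Lemma standard_fun_bound t y :
  `|standard_fun t y| <= (1 - alpha)^-1 * (1 + `|y|).
Proof.
rewrite /standard_fun mulrAC mulrC normrM ger0_norm// ler_wpM2l//.
by rewrite normrM; case: (t < y); rewrite ?normr1 ?normr0 ?mulr1 ?mulr0 ?addr_ge0// lerDr.
Qed.

(** The terms in [t] make the constant depend on [K]; this is why the averaging lemma asks only for
    a local bound. *)
Lemma convexified_fun_bound K t y : `|t| <= K ->
  `|convexified_fun t y| <= (K + (1 - alpha)^-1 * (1 + K)) * (1 + `|y|).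
Proof.
move=> tK; have K0 : 0 <= K := le_trans (normr_ge0 _) tK.
have y0 := normr_ge0 y.
apply: (@le_trans _ _ (K + (1 - alpha)^-1 * (`|y| + K))); last first.
  have := mulr_ge0 K0 y0; have := mulr_ge0 i0 (mulr_ge0 K0 y0).
  by move: i0; set i := (_^-1); nra.
apply: le_trans (ler_normD _ _) _; apply: lerD => //.
rewrite mulrAC mulrC normrM ger0_norm// ler_wpM2l//.
apply: (@le_trans _ _ `|y - t|).
  by rewrite normrM; case: (t < y); rewrite ?normr1 ?normr0 ?mulr1 ?mulr0.
by apply: le_trans (ler_normB _ _) _; rewrite lerD2l.
Qed.

Lemma standard_fun_cvg (q : R) (t : nat -> R) y : y != q -> t @ \oo --> q ->
  standard_fun (t n) y @[n --> \oo] --> standard_fun q y.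
Proof.
by move=> yq tq; apply: cvgM; [exact: cvg_cst|exact: cvg_natr_lt].
Qed.

Lemma convexified_fun_cvg (q : R) (t : nat -> R) y : y != q ->
  t @ \oo --> q ->
  convexified_fun (t n) y @[n --> \oo] --> convexified_fun q y.
Proof.
move=> yq tq; apply: cvgD => //; apply: cvgM; last exact: cvg_natr_lt.
by apply: cvgM; [apply: cvgB => //; exact: cvg_cst|exact: cvg_cst].
Qed.

Context d (T : measurableType d) (P : probability T R).
Variables (X : {RV P >-> R}).

Lemma mean_quantile_fun t : mean X quantile_fun t = fine (cdf X t).
Proof.
rewrite /mean /Rintegral /cdf; congr fine.
rewrite -[RHS]/(P (X @^-1` `]-oo, t])).
rewrite -[X in P X]setIT -integral_indic//; last first.
  by rewrite -[X in measurable X]setTI; exact: measurable_funP.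
apply: eq_integral => w _; rewrite indicE /quantile_fun.
by congr ((nat_of_bool _)%:R%:E); apply/idP/idP => [Xt|/set_mem/=];
  rewrite ?in_itv//; apply/mem_set; rewrite /= in_itv.
Qed.

Variables (f : R -> R) (q : R).
Hypothesis X2 : square_integrable P X.
Hypothesis Xf : has_density X f.
Hypothesis Fq : cdf X q = alpha%:E.

(** The strict inequality in the algorithm and the large one in the superquantile differ only on the
    event where [X] equals [q], which is null since [X] has a density. *)
Lemma mean_standard_fun : mean X standard_fun q = superquantile X q.
Proof.
rewrite (superquantileE Xf Fq) /mean.
have mX1 : measurable_fun setT (fun w => X w * (q < X w)%R%:R).
  apply: measurable_funM => //; apply: measurable_fun_natr_bool.
  exact: measurable_fun_ltr.
have jX1 : P.-integrable setT (EFin \o (fun w => X w * (q < X w)%R%:R)).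
  apply: le_integrable (square_integrableW X2) => //.
    exact/measurable_EFinP.
  move=> w _; rewrite /= lee_fin normrM ler_piMr//.
  by case: (q < X w); rewrite ?normr1 ?normr0.
transitivity (\int[P]_w ((1 - alpha)^-1 * (X w * (q < X w)%R%:R))).
  by apply: eq_Rintegral => w _; rewrite /standard_fun mulrAC mulrC.
rewrite RintegralZl//; congr (_ * _); rewrite unlock /Rintegral; congr fine.
have mI : measurable [set w | q <= X w].
  rewrite -[X in measurable X]setTI.
  have := @measurable_fun_ler _ _ R setT (cst q) X (measurable_cst _)
    (measurable_funP X).
  by move/(_ measurableT [set true] I).
apply: ae_eq_integral => //.
- exact/measurable_EFinP.
- by apply/measurable_EFinP; apply: measurable_funM => //; exact: measurable_indic.
exists (X @^-1` [set q]); split.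
- by rewrite -[X in measurable X]setTI; exact: measurable_funP.
- exact: distribution_set1 Xf.
move=> w /=; apply: contra_notP => /eqP Xw _.
by congr (_ * _)%:E; rewrite indicE mem_setE lt_neqAle eq_sym Xw.
Qed.

(** The convexified function is the standard one plus $q - \frac{q}{1-\alpha} +
    \frac{q}{1-\alpha}\mathbf{1}_{\{X\le q\}}$, and this correction has mean 0 because $F(q) =
    \alpha$. *)
Lemma mean_convexified_fun : mean X convexified_fun q = superquantile X q.
Proof.
have jS := integrable_sublinear X2 measurable_standard_fun standard_fun_bound q.
have jQ := integrable_sublinear X2 measurable_quantile_fun quantile_fun_bound q.
have jc (k : R) : P.-integrable setT (EFin \o cst k).
  exact: finite_measure_integrable_cst.
have jcQ : P.-integrable setT
    (EFin \o (fun w => q / (1 - alpha) * quantile_fun q (X w))).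
  exact: (integrableZl measurableT _ jQ).
rewrite -mean_standard_fun {1}/mean.
transitivity (\int[P]_w ((q - q / (1 - alpha) + standard_fun q (X w)) +
    q / (1 - alpha) * quantile_fun q (X w))).
  apply: eq_Rintegral => w _.
  rewrite /convexified_fun /standard_fun /quantile_fun leNgt.
  by case: (q < X w) => /=; ring.
rewrite RintegralD//; last exact: (integrableD measurableT (jc _) jS).
rewrite RintegralD//; last exact: jc.
rewrite RintegralZl// Rintegral_cst//.
rewrite [X in fine X](probability_setT P) mulr1.
rewrite -[X in _ + _ * X]/(mean X quantile_fun q) mean_quantile_fun Fq/=.
rewrite -[X in _ + X + _]/(mean X standard_fun q).
have a1 : 1 - alpha != 0 by rewrite subr_eq0 gt_eqF.
by field.
Qed.

End algorithm_functions.

(** * Independence of the initial values and the observations *)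

Section initial_history.
Context d (T : measurableType d) (R : realType) (P : probability T R).
Variables (Xs : nat -> {RV P >-> R}) (U V W : {RV P >-> R}).
Hypothesis Xs_independent : mutually_independent [set n | (1 <= n)%N] Xs.
Hypothesis ini_independent : independent_systems P (sigma_of_triple U V W)
  (sigma_of_family [set n | (2 <= n)%N] Xs).

Let E0 := sigma_of_triple U V W.

Lemma sigma_of_triple_measurable : E0 `<=` measurable.
Proof.
move=> _ [B mB <-]; have mUVW : measurable_fun setT (fun w => (U w, V w, W w)).
  by do 2 apply: measurable_fun_pair => //.
exact: mUVW.
Qed.

Lemma sigma_of_triple_setI : setI_closed E0.
Proof.
move=> _ _ [A mA <-] [B mB <-]; exists (A `&` B); first exact: measurableI.
by rewrite !setTI.
Qed.

Lemma sigma_of_triple_setT : E0 setT.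
Proof. by exists setT => //; rewrite setTI. Qed.

Lemma sigma_of_triple_fst B : measurable B -> E0 (U @^-1` B).
Proof.
move=> mB; exists (fst @^-1` (fst @^-1` B)); last by rewrite setTI.
have m1 : measurable_fun setT (fst : R * R * R -> R * R) := @measurable_fst _ _ _ _.
have m2 : measurable_fun setT (fst : R * R -> R) := @measurable_fst _ _ _ _.
rewrite -[X in measurable X]setTI; apply: m1 => //.
by rewrite -[X in measurable X]setTI; exact: m2.
Qed.

(** Independence from the initial triple splits off [A0]; mutual independence then factors the
    finite intersection. The shift by 2 reflects that [Xs 2] is the first observation used. *)
Lemma initial_history_independent A0 (B : nat -> set R) k : E0 A0 ->
  (forall i, measurable (B i)) ->
  P (A0 `&` \bigcap_(i < k) Xs i.+2 @^-1` B i) =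
  (P A0 * \prod_(i < k) P (Xs i.+2 @^-1` B i))%E.
Proof.
move=> EA0 mB; rewrite ini_independent//; last first.
  pose F := \bigcup_(i in [set n | (2 <= n)%N])
    preimage_set_system [set: T] (Xs i) measurable.
  apply: (@fin_bigcap_measurable _ (g_sigma_algebraType F)) => //.
  move=> i _; apply: sub_sigma_algebra; exists i.+2 => //.
  by exists (B i) => //; rewrite setTI.
congr (_ * _)%E.
(* The indices actually involved run from 2 to [k.+1]; the sets [B] are reindexed accordingly by
   [.-2]. *)
pose s := [seq i.+2 | i <- index_iota 0 k].
have -> : \bigcap_(i < k) Xs i.+2 @^-1` B i =
    \bigcap_(i in [set` s]) Xs i @^-1` B i.-2.
  apply/seteqP; split => w H i /=.
    by move=> /mapP[j]; rewrite mem_index_iota => /= jk ->; exact: H.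
  by move=> ik; apply: (H i.+2); apply: map_f; rewrite mem_index_iota.
rewrite Xs_independent ?big_map ?big_mkord//.
  by rewrite map_inj_uniq ?iota_uniq// => i j [].
by move=> i /mapP[j _ ->].
Qed.

End initial_history.


(** * Almost sure convergence of the standard and convexified algorithms *)

Theorem theorem3p1 (d : measure_display) (T : measurableType d) (R : realType)
    (P : probability T R)
    (X : {RV P >-> R}) (f : R -> R) (alpha theta_alpha : R)
    (Xs theta vhat vtilde : nat -> {RV P >-> R}) (a b : nat -> R)
    (X_integrable : (X : T -> R) \in Lfun P 1%E)
    (X_square_integrable : (X : T -> R) \in Lfun P 2%:E)
    (X_cdf_increasing : forall x y : R, x < y -> (cdf X x < cdf X y)%E)
    (X_density : has_density X f)
    (alpha01 : 0 < alpha < 1)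
    (theta_alphaE : cdf X theta_alpha = alpha%:E)
    (f_derivable : forall V : set R, nbhs theta_alpha V ->
       (forall x, V x -> derivable f x 1) /\
       (exists M : R, forall x, V x -> `|derive1 f x| <= M))
    (Xs_independent : mutually_independent [set n | (1 <= n)%N] Xs)
    (Xs_distribution : forall n, (1 <= n)%N -> identically_distributed (Xs n) X)
    (theta1_square_integrable : (theta 1%N : T -> R) \in Lfun P 2%:E)
    (vhat1_square_integrable : (vhat 1%N : T -> R) \in Lfun P 2%:E)
    (vtilde1_square_integrable : (vtilde 1%N : T -> R) \in Lfun P 2%:E)
    (initial_independent : independent_systems P
       (sigma_of_triple (theta 1%N) (vhat 1%N) (vtilde 1%N))
       (sigma_of_family [set n | (2 <= n)%N] Xs))
    (a_step : step_sequence a)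
    (b_step : step_sequence b)
    (theta_rec : quantile_algorithm alpha a Xs theta)
    (vhat_rec : standard_algorithm alpha b Xs theta vhat)
    (vtilde_rec : convexified_algorithm alpha b Xs theta vtilde) :
  {ae P, forall w, vhat n w @[n --> \oo] --> superquantile X theta_alpha} /\
  {ae P, forall w, vtilde n w @[n --> \oo] --> superquantile X theta_alpha}.
Proof.
have /andP[_ alpha1] := alpha01.
have X2 : square_integrable P X.
  by split; [exact: measurable_funP|exact: Lfun2_integrable_sqr].
pose E0 := sigma_of_triple (theta 1%N) (vhat 1%N) (vtilde 1%N).
(* From index 0, [Y k] is the observation that moves [theta k.+1], renamed [x k] below, to
   [theta k.+2]. *)
pose Y k := Xs k.+2.
have mE0 : E0 `<=` measurable := @sigma_of_triple_measurable _ _ _ _ _ _ _.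
have E0I : setI_closed E0 := @sigma_of_triple_setI _ _ _ _ _ _ _.
have E0T : E0 setT := sigma_of_triple_setT _ _ _.
have indep := initial_history_independent Xs_independent initial_independent.
have YX k : identically_distributed (Y k) X by exact: Xs_distribution.
pose x k (w : T) := theta k.+1 w.
have xE k w : x k.+1 w = x k w - a k.+1 * (quantile_fun (x k w) (Y k w) - alpha).
  by rewrite /x theta_rec.
(* By induction, [x k] depends only on the initial triple and on [Y 0], ..., [Y k.-1], hence is
   independent of [Y k]. *)
have mx k : measurable_fun setT (x k : g_sigma_algebraType (history E0 Y k) -> R).
  elim: k => [|k IH].
    move=> _ B mB; rewrite setTI; apply: sub_sigma_algebra; apply: history_ini.
    exact: sigma_of_triple_fst.
  have sub : history E0 Y k `<=` <<s history E0 Y k.+1 >>.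
    by move=> A hA; apply: sub_sigma_algebra; exact: sub_history.
  have mxS := measurable_fun_g_sigma sub IH.
  have mYS := measurable_fun_history E0T (Y := Y) (k := k).
  rewrite (_ : x k.+1 =
    (fun w => x k w - a k.+1 * (quantile_fun (x k w) (Y k w) - alpha))).
    apply: measurable_funB => //; apply: measurable_funM => //.
    apply: measurable_funB => //.
    exact: (measurable_fun_comp2 (@measurable_quantile_fun R) mxS mYS).
  by apply/funext => w; exact: xE.
have F01 t : 0 <= mean X (@quantile_fun R) t <= 1.
  rewrite mean_quantile_fun fine_ge0//= -lee_fin fineK ?cdf_le1//.
  exact: fin_num_measure.
have Fincr : {homo mean X (@quantile_fun R) : s t / s < t}.
  move=> s t /X_cdf_increasing; rewrite !mean_quantile_fun -lte_fin !fineK//;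
    exact: fin_num_measure.
(* The mean of [quantile_fun] is the cumulative distribution function, strictly increasing and equal
   to [alpha] at [theta_alpha]. The quantile algorithm is thus a root-finding recursion whose error
   is the centred indicator. *)
have xq : {ae P, forall w, x n w @[n --> \oo] --> theta_alpha}.
  have := noise_series_cvg mE0 E0I E0T indep X2 YX (@measurable_quantile_fun R)
    (@quantile_fun_bound R) mx (step_sequence_sqr a_step).
  apply: filterS => w noise.
  apply: (root_finding_cvg (alpha := alpha) Fincr F01 _ _ (step_sequence_cvg0 a_step)
    (step_sequence_series a_step) noise).
  - by rewrite mean_quantile_fun theta_alphaE.
  - by move=> n; have /andP[/ltW] := step_sequence_bounds a_step n.
  - by move=> n; rewrite xE /Y; ring.
have Xq := distribution_set1 theta_alpha X_density.
have b01 n : 0 <= b n.+1 <= 1.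
  by have /andP[/ltW -> /ltW ->] := step_sequence_bounds b_step n.
split.
(* The averaging lemma applies to the shifted sequence, and its limit is the mean of [standard_fun]
   at [theta_alpha], that is, the superquantile. *)
- have : {ae P, forall w, vhat n.+1 w @[n --> \oo] --> superquantile X theta_alpha}.
    rewrite -(mean_standard_fun X2 X_density theta_alphaE).
    apply: (averaging_algorithm_cvg mE0 E0I E0T indep X2 YX Xq
      (measurable_standard_fun alpha) _ _ mx b01
      (step_sequence_series b_step) (step_sequence_sqr b_step) _ xq).
    + move=> K; exists (1 - alpha)^-1 => t y _; exact: standard_fun_bound.
    + by move=> t y; exact: standard_fun_cvg.
    + by move=> n w; exact: vhat_rec.
  by apply: filterS => w; rewrite (cvg_shiftS (vhat ^~ w)).
- have : {ae P, forall w, vtilde n.+1 w @[n --> \oo] --> superquantile X theta_alpha}.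
    rewrite -(mean_convexified_fun alpha1 X2 X_density theta_alphaE).
    apply: (averaging_algorithm_cvg mE0 E0I E0T indep X2 YX Xq
      (measurable_convexified_fun alpha) _ _ mx b01
      (step_sequence_series b_step) (step_sequence_sqr b_step) _ xq).
    + by move=> K; exists (K + (1 - alpha)^-1 * (1 + K)) => t y;
        exact: convexified_fun_bound.
    + by move=> t y; exact: convexified_fun_cvg.
    + by move=> n w; exact: vtilde_rec.
  by apply: filterS => w; rewrite (cvg_shiftS (vtilde ^~ w)).
Qed.
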